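(* Let $X$ be a non-empty set, $n\ge1$ an integer, and let $F=\{\frac{f}{1+g}\mid f,g\in\langle X\rangle_{id}\}\subset\mathbb Q(X)$ be the free commutative radical ring on $X$. Then $$F^{(n)}=\Big\{\frac{f}{1+g}\ \Big|\ f\in\langle X\rangle_{id}^{\,n},\ g\in\langle X\rangle_{id}\Big\}.$$ Moreover, the quotient $F^{(n)}/F^{(n+1)}$ is isomorphic to the trivial skew brace on the free abelian group $F^{\mathrm{ab}}(M_n)$, where $M_n$ denotes the set of monomials of total degree $n$ in the variables $X$. The quotient map can be written explicitly as $$\xi\colon F^{(n)}\to F^{\mathrm{ab}}(M_n),\qquad \frac{f}{1+g}\mapsto\bar f,$$ where $f\in\langle X\rangle_{id}^{\,n}$, $g\in\langle X\rangle_{id}$, and $f\mapsto\bar f$ is the quotient map $\langle X\rangle_{id}^{\,n}\to\langle X\rangle_{id}^{\,n}/\langle X\rangle_{id}^{\,n+1}\cong F^{\mathrm{ab}}(M_n)$.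
   Context: A skew brace is a triple $(B,+,\circ)$ with $(B,+)$ and $(B,\circ)$ groups such that $a\circ(b+c)=a\circ b-a+a\circ c$; put $a*b=-a+a\circ b-b$. Put $B^{(1)}=B$ and let $B^{(k+1)}$ be the subgroup of $(B,+)$ generated by all $a*b$ with $a\in B^{(k)}$, $b\in B$ (these are ideals). The trivial skew brace on a group $(G,\cdot)$ is $(G,\cdot,\cdot)$. A commutative radical ring is the same as a skew brace with $(B,+)$ and $(B,\circ)$ both abelian, with ring product $*$. $\langle X\rangle_{id}$ is the ideal of the commutative polynomial ring $\mathbb Z[X]$ generated by $X$, and $\mathbb Q(X)$ is the field of rational functions. The set $F$ with the usual addition of functions and $r\circ s=r+rs+s$ is the free commutative radical ring on $X$; in it $*$ is the usual multiplication of functions. *)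

(* Defs.v *)
From HB Require Import structures.
From mathcomp Require Import all_boot all_order all_algebra.
From mathcomp Require Import boolp classical_sets.
From mathcomp Require Import finmap.
From mathcomp Require Import monalg.
From mathcomp Require Import ring.

Set Implicit Arguments.
Unset Strict Implicit.
Unset Printing Implicit Defensive.

Import GRing.Theory.

Local Open Scope classical_set_scope.
Local Open Scope quotient_scope.
Local Open Scope ring_scope.

Definition is_group (T : Type) (op : T -> T -> T) (e : T) (inv : T -> T) :=
  [/\ associative op, left_id e op, right_id e op,
      left_inverse e inv op & right_inverse e inv op].

Declare Scope brace_scope.
Delimit Scope brace_scope with B.

Record skewBrace := SkewBrace {
  sb_sort :> choiceType;
  sb_add : sb_sort -> sb_sort -> sb_sort;
  sb_zero : sb_sort;
  sb_opp : sb_sort -> sb_sort;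
  sb_circ : sb_sort -> sb_sort -> sb_sort;
  sb_one : sb_sort;
  sb_inv : sb_sort -> sb_sort;
  sb_add_group : is_group sb_add sb_zero sb_opp;
  sb_circ_group : is_group sb_circ sb_one sb_inv;
  sb_circD : forall a b c, sb_circ a (sb_add b c) =
    sb_add (sb_add (sb_circ a b) (sb_opp a)) (sb_circ a c) }.

Bind Scope brace_scope with sb_sort.
Arguments sb_zero {s}.
Arguments sb_one {s}.
Notation "0" := sb_zero : brace_scope.
Notation "x + y" := (sb_add x y) : brace_scope.
Notation "- x" := (sb_opp x) : brace_scope.
Notation "x - y" := (sb_add x (sb_opp y)) : brace_scope.
Notation "x ∘ y" := (sb_circ x y)
  (at level 40, left associativity) : brace_scope.

Definition star (B : skewBrace) (a b : B) : B := (- a + a ∘ b - b)%B.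
Notation "x * y" := (star x y) : brace_scope.

Definition lam (B : skewBrace) (a b : B) : B := (- a + a ∘ b)%B.

Fact trivBrace_group (V : zmodType) :
  is_group (@GRing.add V) 0 (@GRing.opp V).
Proof.
by split; [exact: addrA | exact: add0r | exact: addr0 | exact: addNr
          | exact: addrN].
Qed.

Fact trivBrace_circD (V : zmodType) (a b c : V) :
  a + (b + c) = a + b - a + (a + c).
Proof. by rewrite [a + b]addrC addrK addrCA. Qed.

(* The trivial skew brace (V, +, +) on an abelian group. *)
Definition trivBrace (V : zmodType) : skewBrace :=
  SkewBrace (trivBrace_group V) (trivBrace_group V) (@trivBrace_circD V).

Definition brace_hom (A B : skewBrace) (f : A -> B) :=
  (forall x y, f (x + y)%B = (f x + f y)%B) /\
  (forall x y, f (x ∘ y)%B = (f x ∘ f y)%B).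

Definition brace_iso (A B : skewBrace) (f : A -> B) :=
  brace_hom f /\ bijective f.

Definition add_subgroup (B : skewBrace) (S : set B) :=
  [/\ S 0%B, forall x y, S x -> S y -> S (x + y)%B
    & forall x, S x -> S (- x)%B].

Definition add_gen (B : skewBrace) (S : set B) : set B :=
  [set x | forall H : set B, add_subgroup H -> S `<=` H -> H x].

Definition sub_brace (B : skewBrace) (S : set B) :=
  [/\ add_subgroup S, S sb_one, forall x y, S x -> S y -> S (x ∘ y)%B
    & forall x, S x -> S (sb_inv x)].

Definition brace_ideal (B : skewBrace) (I : set B) :=
  [/\ add_subgroup I,
      forall a x, I x -> I (lam a x),
      forall a x, I x -> I (a + x - a)%B
    & forall a x, I x -> I (a ∘ x ∘ sb_inv a)%B].

Definition star_gen (B : skewBrace) (I : set B) : set B :=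
  add_gen [set c | exists2 a, I a & exists b, c = (a * b)%B].

(* B^(k) is [bseries B k] for k >= 1; [bseries B 0] is B as well. *)
Definition bseries (B : skewBrace) (k : nat) : set B :=
  iter k.-1 (@star_gen B) setT.
Arguments bseries : clear implicits.

Section GroupFacts.
Variables (T : Type) (op : T -> T -> T) (e : T) (inv : T -> T).
Hypothesis G : is_group op e inv.

Lemma grpA : associative op. Proof. by case: G. Qed.
Lemma grp1x : left_id e op. Proof. by case: G. Qed.
Lemma grpx1 : right_id e op. Proof. by case: G. Qed.
Lemma grpVx : left_inverse e inv op. Proof. by case: G. Qed.
Lemma grpxV : right_inverse e inv op. Proof. by case: G. Qed.
Lemma grpKV x y : op (inv x) (op x y) = y.
Proof. by rewrite grpA grpVx grp1x. Qed.
Lemma grpVK x y : op x (op (inv x) y) = y.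
Proof. by rewrite grpA grpxV grp1x. Qed.
Lemma grpI x y z : op x y = op x z -> y = z.
Proof. by move=> E; rewrite -(grpKV x y) E grpKV. Qed.
Lemma grp_invE x y : op x y = e -> inv x = y.
Proof. by move=> E; apply: (@grpI x); rewrite grpxV E. Qed.
Lemma grp_invK x : inv (inv x) = x.
Proof. by apply: grp_invE; rewrite grpVx. Qed.
Lemma grp_invM x y : inv (op x y) = op (inv y) (inv x).
Proof. by apply: grp_invE; rewrite -grpA grpVK grpxV. Qed.
End GroupFacts.

Section BraceFacts.
Variable B : skewBrace.
Implicit Types (a b c x y z : B) (I : set B).
Local Open Scope brace_scope.
Let aG := sb_add_group B.
Let cG := sb_circ_group B.

Lemma sb_circx0 a : a ∘ 0 = a.
Proof.
have := sb_circD a 0 0; rewrite (grp1x aG) -(grpA aG).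
rewrite -[LHS](grpx1 aG) => /(grpI aG) /esym /(grp_invE aG).
by rewrite (grp_invK aG).
Qed.

Lemma sb_one0 : sb_one = 0 :> B.
Proof. by rewrite -[LHS]sb_circx0 (grp1x cG). Qed.

Lemma sb_circE a b : a ∘ b = a + lam a b.
Proof. by rewrite /lam (grpVK aG). Qed.

Lemma lamD a b c : lam a (b + c) = lam a b + lam a c.
Proof. by rewrite /lam sb_circD !(grpA aG). Qed.

Lemma lam0 a : lam a 0 = 0.
Proof. by rewrite /lam sb_circx0 (grpVx aG). Qed.

Lemma lamN a b : lam a (- b) = - lam a b.
Proof.
by apply/esym/(grp_invE aG); rewrite -lamD (grpxV aG) lam0.
Qed.

Lemma lamM a b c : lam (a ∘ b) c = lam a (lam b c).
Proof.
rewrite {3}/lam lamD lamN /lam (grp_invM aG) (grp_invK aG) -!(grpA aG).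
by rewrite (grpVK aG) (grpA cG).
Qed.

Lemma lam1 b : lam sb_one b = b.
Proof. by rewrite /lam (grp1x cG) sb_one0 -{2}(grpKV aG 0 b) (grp1x aG). Qed.

Lemma lamVE a : lam a (sb_inv a) = - a.
Proof. by rewrite /lam (grpxV cG) sb_one0 (grpx1 aG). Qed.

Lemma starE a b : a * b = lam a b - b.
Proof. by []. Qed.

Lemma lamE a b : lam a b = a * b + b.
Proof. by rewrite starE -(grpA aG) (grpVx aG) (grpx1 aG). Qed.

Section Gen.
Variable S : set B.
Lemma add_gen_sub : S `<=` add_gen S.
Proof. by move=> x Sx H _; apply. Qed.
Lemma add_gen_subgroup : add_subgroup (add_gen S).
Proof.
split=> [H [] //|x y Sx Sy H HH sSH|x Sx H HH sSH]; have [_ HD HN] := HH.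
  by apply: HD; [exact: Sx | exact: Sy].
by apply: HN; exact: Sx.
Qed.
End Gen.

(* [add_gen S] is stable under the additive endomorphisms f that map S to
   [add_gen S]. *)
Lemma add_gen_morph S (f : B -> B) :
  f 0 = 0 -> (forall x y, f (x + y) = f x + f y) ->
  (forall x, f (- x) = - f x) ->
  (forall x, S x -> add_gen S (f x)) -> forall x, add_gen S x -> add_gen S (f x).
Proof.
move=> f0 fD fN fS x Sx; have [g0 gD gN] := add_gen_subgroup S.
apply: (Sx [set y | add_gen S (f y)]) => //=; split=> /= [|y z|y].
- by rewrite f0.
- by rewrite fD; exact: gD.
by rewrite fN; exact: gN.
Qed.

Lemma star_gen_ideal I : brace_ideal I ->
  star_gen I `<=` I /\ brace_ideal (star_gen I).
Proof.
move=> [Isub Ilam Iconj Icirc]; have [I0 ID IN] := Isub.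
have gsub := add_gen_subgroup [set c | exists2 a, I a & exists b, c = a * b].
have [g0 gD gN] := gsub.
have starI a b : I a -> I (a * b).
  move=> Ia; rewrite /star -(grpA aG); apply: ID; first exact: IN.
  have -> : a ∘ b = b ∘ (sb_inv b ∘ a ∘ sb_inv (sb_inv b)).
    by rewrite (grp_invK cG) !(grpA cG) (grpxV cG) (grp1x cG).
  by rewrite sb_circE; apply: Iconj; apply: Ilam; apply: Icirc.
have starG a b : I a -> star_gen I (a * b).
  by move=> Ia; apply: add_gen_sub; exists a => //; exists b.
have sub : star_gen I `<=` I.
  by move=> x; apply=> // _ [a Ia [b ->]]; exact: starI.
have Glam a x : star_gen I x -> star_gen I (lam a x).
  apply: add_gen_morph => [|y z|y|_ [y Iy [b ->]]].
  - exact: lam0.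
  - exact: lamD.
  - exact: lamN.
  rewrite starE lamD lamN.
  have -> : lam a (lam y b) = lam (a ∘ y ∘ sb_inv a) (lam a b).
    by rewrite -!lamM -!(grpA cG) (grpVx cG) (grpx1 cG).
  by rewrite -starE; apply: starG; exact: Icirc.
have Gconj a x : star_gen I x -> star_gen I (a + x - a).
  apply: (@add_gen_morph _ (fun x => a + x - a)) => [|y z|y|_ [y Iy [b ->]]].
  - by rewrite (grpx1 aG) (grpxV aG).
  - by rewrite -!(grpA aG) (grpKV aG).
  - by rewrite !(grp_invM aG) (grp_invK aG) !(grpA aG).
  have -> : a + y * b - a = - (y * a) + y * (a + b).
    rewrite !starE lamD; move: (lam y a) (lam y b) => u v.
    by rewrite !(grp_invM aG) (grp_invK aG) -!(grpA aG) (grpKV aG).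
  by apply: gD; [apply: gN | ]; exact: starG.
split=> //; split=> // a x Gx.
have -> : a ∘ x ∘ sb_inv a = a + lam a (x + x * sb_inv a) - a.
  rewrite -(grpA cG) sb_circE [x ∘ _]sb_circE [lam x (sb_inv a)]lamE (grpA aG).
  by rewrite lamD lamVE (grpA aG).
by apply: Gconj; apply: Glam; apply: gD => //; apply: starG; exact: sub.
Qed.

Lemma bseries_ideal k : brace_ideal (bseries B k).
Proof.
have idT : brace_ideal [set: B] by split=> //; split.
case: k => [|k]; first exact: idT.
rewrite /bseries /=; elim: k => [|k IHk]; first exact: idT.
by have [] := star_gen_ideal IHk.
Qed.

Lemma bseriesS k : (0 < k)%N -> bseries B k.+1 = star_gen (bseries B k).
Proof. by case: k. Qed.

Lemma bseries_sub k : bseries B k.+1 `<=` bseries B k.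
Proof.
case: k => [|k]; first by [].
by rewrite bseriesS //; have [] := star_gen_ideal (bseries_ideal k.+1).
Qed.

Lemma ideal_circE I : brace_ideal I ->
  forall x y, I (- x + y) <-> I (sb_inv x ∘ y).
Proof.
move=> [_ Ilam _ _] x y.
have E : sb_inv x ∘ y = lam (sb_inv x) (- x + y).
  have Ex : lam (sb_inv x) (- x) = sb_inv x.
    by rewrite lamN -{2}(grp_invK cG x) lamVE (grp_invK aG).
  by rewrite lamD Ex -sb_circE.
split=> [Iy|]; first by rewrite E; exact: Ilam.
rewrite E => /(Ilam x); rewrite -lamM (grpxV cG).
by rewrite lam1.
Qed.

Lemma ideal_sub_brace I : brace_ideal I -> sub_brace I.
Proof.
move=> HI; have [Isub Ilam Iconj Icirc] := HI; have [I0 ID IN] := Isub.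
have IC x y : I x -> I y -> I (x ∘ y).
  by move=> Ix Iy; rewrite sb_circE; apply: ID => //; exact: Ilam.
split=> //; first by rewrite sb_one0.
move=> x Ix; have := ideal_circE HI x 0; rewrite (grpx1 aG) sb_circx0 => -[].
by move=> /(_ (IN _ Ix)).
Qed.

Lemma bseries_sub_brace k : sub_brace (bseries B k).
Proof. exact: ideal_sub_brace (bseries_ideal k). Qed.

End BraceFacts.

Section SubBrace.
Variables (B : skewBrace) (S : set B) (HS : sub_brace S).
Local Open Scope brace_scope.

Let valS (a : S) : S (val a). Proof. exact: set_valP. Qed.

Definition sub_mk (x : B) (Sx : S x) : S := exist _ x (mem_set Sx).

Fact sub_addP (a b : S) : S (val a + val b).
Proof. by have [[_ D _] _ _ _] := HS; exact: D. Qed.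
Fact sub_zeroP : S 0. Proof. by have [[]] := HS. Qed.
Fact sub_oppP (a : S) : S (- val a).
Proof. by have [[_ _ N] _ _ _] := HS; exact: N. Qed.
Fact sub_circP (a b : S) : S (val a ∘ val b).
Proof. by have [_ _ C _] := HS; exact: C. Qed.
Fact sub_oneP : S sb_one. Proof. by have [] := HS. Qed.
Fact sub_invP (a : S) : S (sb_inv (val a)).
Proof. by have [_ _ _ V] := HS; exact: V. Qed.

Fact sub_add_group : is_group (fun a b => sub_mk (sub_addP a b))
  (sub_mk sub_zeroP) (fun a => sub_mk (sub_oppP a)).
Proof.
have G := sb_add_group B.
split=> [a b c|a|a|a|a]; apply: val_inj => /=.
- exact: (grpA G).
- exact: (grp1x G).
- exact: (grpx1 G).
- exact: (grpVx G).
exact: (grpxV G).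
Qed.

Fact sub_circ_group : is_group (fun a b => sub_mk (sub_circP a b))
  (sub_mk sub_oneP) (fun a => sub_mk (sub_invP a)).
Proof.
have G := sb_circ_group B.
split=> [a b c|a|a|a|a]; apply: val_inj => /=.
- exact: (grpA G).
- exact: (grp1x G).
- exact: (grpx1 G).
- exact: (grpVx G).
exact: (grpxV G).
Qed.

Fact sub_circD (a b c : S) :
  sub_mk (sub_circP a (sub_mk (sub_addP b c))) =
  sub_mk (sub_addP
    (sub_mk (sub_addP (sub_mk (sub_circP a b)) (sub_mk (sub_oppP a))))
    (sub_mk (sub_circP a c))).
Proof. by apply: val_inj; exact: sb_circD. Qed.

Definition subBrace : skewBrace :=
  @SkewBrace S _ _ _ _ _ _ sub_add_group sub_circ_group sub_circD.

End SubBrace.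

Section QuotBrace.
Variables (B : skewBrace) (I : set B) (HI : brace_ideal I).
Local Open Scope brace_scope.
Let aG := sb_add_group B.
Let cG := sb_circ_group B.

(* The cosets of an ideal for + and for ∘ coincide ([ideal_circE]). *)
Definition coset_rel (x y : B) : bool := `[< I (- x + y) >].

Fact coset_rel_equiv : equiv_class_of coset_rel.
Proof.
have [[I0 ID IN] _ _ _] := HI.
split=> [x|x y|y x z].
- by apply/asboolP; rewrite (grpVx aG).
- by apply/asboolP/asboolP => /IN; rewrite (grp_invM aG) (grp_invK aG).
move=> /asboolP xy /asboolP yz; apply/asboolP.
by rewrite -(grpVK aG y z) (grpA aG); exact: ID.
Qed.

Canonical coset_equiv := EquivRelPack coset_rel_equiv.
Canonical coset_encModRel := defaultEncModRel coset_rel.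

Definition quot_type := {eq_quot coset_rel}.
HB.instance Definition _ : EqQuotient B coset_rel quot_type :=
  EqQuotient.on quot_type.
HB.instance Definition _ := Choice.on quot_type.

Fact quotP (x y : B) : I (- x + y) <-> \pi_quot_type x = \pi_quot_type y.
Proof.
by split=> [h|/eqquotP/asboolP//]; apply/eqquotP/asboolP.
Qed.

Lemma repr_quot (x : B) : I (- repr (\pi_quot_type x) + x).
Proof. by apply/quotP; rewrite reprK. Qed.

Definition quot_add (u v : quot_type) := \pi_quot_type (repr u + repr v).
Definition quot_opp (u : quot_type) := \pi_quot_type (- repr u).
Definition quot_circ (u v : quot_type) := \pi_quot_type (repr u ∘ repr v).
Definition quot_inv (u : quot_type) := \pi_quot_type (sb_inv (repr u)).

Lemma pi_addE x y :
  quot_add (\pi_quot_type x) (\pi_quot_type y) = \pi_quot_type (x + y).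
Proof.
have [[I0 ID IN] _ Iconj _] := HI; apply/quotP.
set x' := repr _; set y' := repr _.
have -> : - (x' + y') + (x + y) = (- y' + (- x' + x) - - y') + (- y' + y).
  rewrite (grp_invM aG) (grp_invK aG) -!(grpA aG).
  by rewrite (grpVK aG).
by apply: ID; [apply: Iconj |]; exact: repr_quot.
Qed.

Lemma pi_oppE x : quot_opp (\pi_quot_type x) = \pi_quot_type (- x).
Proof.
have [[I0 ID IN] _ Iconj _] := HI; apply/quotP.
set x' := repr _.
have -> : - - x' - x = x' + - (- x' + x) - x'.
  by rewrite (grp_invM aG) !(grp_invK aG) -!(grpA aG) (grpxV aG) (grpx1 aG).
by apply: Iconj; apply: IN; exact: repr_quot.
Qed.

Lemma pi_circE x y :
  quot_circ (\pi_quot_type x) (\pi_quot_type y) = \pi_quot_type (x ∘ y).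
Proof.
have [_ _ _ Icirc] := HI; have [_ _ IC _] := ideal_sub_brace HI.
apply/quotP/(ideal_circE HI); set x' := repr _; set y' := repr _.
have -> : sb_inv (x' ∘ y') ∘ (x ∘ y) =
  (sb_inv y' ∘ (sb_inv x' ∘ x) ∘ sb_inv (sb_inv y')) ∘ (sb_inv y' ∘ y).
  by rewrite (grp_invM cG) (grp_invK cG) -!(grpA cG) (grpVK cG).
by apply: IC; [apply: Icirc |]; apply/(ideal_circE HI); exact: repr_quot.
Qed.

Lemma pi_invE x : quot_inv (\pi_quot_type x) = \pi_quot_type (sb_inv x).
Proof.
have [_ _ _ Icirc] := HI; have [_ _ _ IV] := ideal_sub_brace HI.
apply/quotP/(ideal_circE HI); set x' := repr _.
have -> : sb_inv (sb_inv x') ∘ sb_inv x =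
  x' ∘ sb_inv (sb_inv x' ∘ x) ∘ sb_inv x'.
  by rewrite (grp_invM cG) !(grp_invK cG) -!(grpA cG) (grpxV cG) (grpx1 cG).
by apply: Icirc; apply: IV; apply/(ideal_circE HI); exact: repr_quot.
Qed.

Fact quot_add_group : is_group quot_add (\pi_quot_type 0) quot_opp.
Proof.
split; first by
  elim/quotW=> x; elim/quotW=> y; elim/quotW=> z;
  rewrite (pi_addE y z) (pi_addE x y) (pi_addE x) (pi_addE _ z) (grpA aG).
- by elim/quotW=> x; rewrite (pi_addE 0 x) (grp1x aG).
- by elim/quotW=> x; rewrite (pi_addE x 0) (grpx1 aG).
- by elim/quotW=> x; rewrite (pi_oppE x) (pi_addE _ x) (grpVx aG).
by elim/quotW=> x; rewrite (pi_oppE x) (pi_addE x) (grpxV aG).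
Qed.

Fact quot_circ_group : is_group quot_circ (\pi_quot_type sb_one) quot_inv.
Proof.
split; first by
  elim/quotW=> x; elim/quotW=> y; elim/quotW=> z;
  rewrite (pi_circE y z) (pi_circE x y) (pi_circE x) (pi_circE _ z) (grpA cG).
- by elim/quotW=> x; rewrite (pi_circE sb_one x) (grp1x cG).
- by elim/quotW=> x; rewrite (pi_circE x sb_one) (grpx1 cG).
- by elim/quotW=> x; rewrite (pi_invE x) (pi_circE _ x) (grpVx cG).
by elim/quotW=> x; rewrite (pi_invE x) (pi_circE x) (grpxV cG).
Qed.

Fact quot_circD (a b c : quot_type) :
  quot_circ a (quot_add b c) =
  quot_add (quot_add (quot_circ a b) (quot_opp a)) (quot_circ a c).
Proof.
elim/quotW: a => x; elim/quotW: b => y; elim/quotW: c => z.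
rewrite (pi_addE y z) (pi_circE x y) (pi_circE x z) (pi_oppE x).
by rewrite (pi_circE x) (pi_addE (x ∘ y)) (pi_addE _ (x ∘ z)) sb_circD.
Qed.

Definition quotBrace : skewBrace :=
  @SkewBrace quot_type _ _ _ _ _ _ quot_add_group quot_circ_group quot_circD.

Definition quotBrace_pi (x : B) : quotBrace := \pi_quot_type x.

End QuotBrace.

Section SeriesQuotient.
Variables (B : skewBrace) (k : nat).

Definition bseriesB : skewBrace := subBrace (bseries_sub_brace B k).

Definition bseries_val (a : bseriesB) : B := \val (a : bseries B k).

(* B^(k+1) as a subset of B^(k); it is contained in B^(k) by [bseries_sub]. *)
Definition bseries_next : set bseriesB :=
  [set a : bseries B k | bseries B k.+1 (val a)].

Fact bseries_next_ideal : brace_ideal bseries_next.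
Proof.
have [[I0 ID IN] Ilam Iconj Icirc] := bseries_ideal B k.+1.
split=> [|a x Ix|a x Ix|a x Ix].
- split=> [|x y Ix Iy|x Ix]; [exact: I0 | exact: ID | exact: IN].
- exact: Ilam.
- exact: Iconj.
exact: Icirc.
Qed.

Definition bseries_quot : skewBrace := quotBrace bseries_next_ideal.

Definition bseries_pi : bseriesB -> bseries_quot :=
  quotBrace_pi bseries_next_ideal.

End SeriesQuotient.

Section MonomialWeight.
Variables (X : choiceType) (N : nat).
Local Open Scope nat_scope.

(* A morphism from monomials to nat, injective on the monomials with support
   in s and exponents < N. *)
Fixpoint mweightN (s : seq X) (m : {cmonom X}) : nat :=
  if s is x :: s' then m x + mweightN s' m * N else 0.

Lemma mweightN1 s : mweightN s mone = 0.
Proof. by elim: s => //= x s ->; rewrite cm1 mul0n. Qed.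

Lemma mweightNM s m1 m2 :
  mweightN s (mmul m1 m2) = mweightN s m1 + mweightN s m2.
Proof. by elim: s => //= x s ->; rewrite cmM mulnDl addnACA. Qed.

Lemma mweightN_inj s (m1 m2 : {cmonom X}) :
  (forall x, m1 x < N) -> (forall x, m2 x < N) ->
  mweightN s m1 = mweightN s m2 -> {in s, forall x, m1 x = m2 x}.
Proof.
move=> b1 b2; elim: s => //= y s IHs E.
have N0 : 0 < N by apply: leq_ltn_trans (b1 y).
have E1 : m1 y = m2 y.
  by move: (congr1 (modn^~ N) E); rewrite ![_ + _ * N]addnC !modnMDl !modn_small.
have E2 : mweightN s m1 = mweightN s m2.
  by move/eqP: E; rewrite E1 eqn_add2l eqn_pmul2r // => /eqP.
by move=> x; rewrite inE => /predU1P[->//|]; exact: IHs.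
Qed.

End MonomialWeight.

(* The polynomials over R in the possibly infinitely many variables X form an
   integral domain: Kronecker substitution maps two given nonzero polynomials
   to nonzero univariate ones. *)
Section PolyIdomain.
Variables (X : choiceType) (R : idomainType).
Implicit Types p q : {malg R[{cmonom X}]}.

Definition monX (N : nat) (s : seq X) (m : {cmonom X}) : {poly R} :=
  'X^(mweightN N s m).

Fact monX_mmorphism N s : mmorphism (monX N s).
Proof.
by split=> [m1 m2|]; rewrite /monX ?mweightNM ?exprD // mweightN1 expr0.
Qed.
HB.instance Definition _ N s := isMultiplicative.Build _ _ (monX N s)
  (monX_mmorphism N s).

Definition kron N s p : {poly R} := mmap polyC (monX N s) p.

Lemma kron_neq0 p (N : nat) (s : seq X) :
  {in msupp p, forall (m : {cmonom X}) x, (m x < N)%N} ->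
  {in msupp p, forall m : {cmonom X}, {subset finsupp m <= s}} ->
  p != 0 -> kron N s p != 0.
Proof.
move=> bp sp p0.
have /fset0Pn[m0 m0p] : msupp p != fset0 by rewrite msupp_eq0.
apply/negP => /eqP/(congr1 (fun r : {poly R} => r`_(mweightN N s m0))).
rewrite coef0 /kron mmapE coef_sum (big_fsetD1 m0) //=.
rewrite coefCM coefXn eqxx mulr1 big_seq big1 ?addr0 => [/eqP|m].
  by rewrite mcoeff_eq0 m0p.
rewrite in_fsetD1 => /andP[mm0 mp]; rewrite coefCM coefXn.
case: eqP => [/esym E|_]; last by rewrite mulr0.
case/eqP: mm0; apply/eqP/cmP => x.
have [xs|xs] := boolP (x \in s).
  by apply: (mweightN_inj (bp _ mp) (bp _ m0p) E).
have mx0 m' : m' \in msupp p -> m' x = 0%N.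
  move=> m'p; apply/eqP; rewrite cmE_eq0; apply: contra xs; exact: sp.
by rewrite !mx0.
Qed.

Lemma cm_bound (d : {fset {cmonom X}}) :
  exists N, {in d, forall (m : {cmonom X}) x, (m x < N)%N}.
Proof.
exists (\sum_(m <- d) mdeg m).+1 => m md x; rewrite ltnS.
rewrite (big_fsetD1 m) //= (leq_trans _ (leq_addr _ _)) //.
have [xm|] := boolP (x \in finsupp m); last by rewrite -cmE_eq0 => /eqP->.
by rewrite mdegE (big_fsetD1 x) //= leq_addr.
Qed.

Lemma cm_supp (d : {fset {cmonom X}}) :
  exists s : seq X, {in d, forall m : {cmonom X}, {subset finsupp m <= s}}.
Proof.
exists (flatten [seq enum_fset (finsupp (m : {cmonom X})) | m <- enum_fset d]) => m md x xm.
by apply/flattenP; exists (enum_fset (finsupp m)) => //; apply: (map_f (fun m : {cmonom X} => enum_fset (finsupp m))).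
Qed.

Lemma mpolyX_mulf p q : p * q = 0 -> p = 0 \/ q = 0.
Proof.
move=> pq0.
have [N bN] := cm_bound (msupp p `|` msupp q)%fset.
have [s bs] := cm_supp (msupp p `|` msupp q)%fset.
have : kron N s p * kron N s q = 0 by rewrite -rmorphM pq0 rmorph0.
have Hk r : (msupp r `<=` msupp p `|` msupp q)%fset ->
    kron N s r = 0 -> r = 0.
  move=> /fsubsetP rs /eqP; have [//|r0] := eqVneq r 0.
  rewrite (negbTE (kron_neq0 _ _ r0)) // => m mr; [exact: bN (rs _ mr)|].
  exact: bs (rs _ mr).
move/eqP; rewrite mulf_eq0 => /orP[]/eqP/Hk H; [left | right].
  by apply: H; rewrite fsubsetUl.
by apply: H; rewrite fsubsetUr.
Qed.

(* The inverse of a non-invertible polynomial is set to itself. *)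
Definition mpolyX_unit p : bool := `[< exists q, q * p = 1 >].
Definition mpolyX_inv p :=
  if pselect (exists q, q * p = 1) is left h then projT1 (cid h) else p.

Fact mpolyX_mulVr : {in mpolyX_unit, left_inverse 1 mpolyX_inv *%R}.
Proof.
move=> p /asboolP h; rewrite /mpolyX_inv; case: pselect => // h'.
exact: projT2 (cid h').
Qed.
Fact mpolyX_unitP p q : q * p = 1 -> mpolyX_unit p.
Proof. by move=> h; apply/asboolP; exists q. Qed.
Fact mpolyX_inv_out : {in [predC mpolyX_unit], mpolyX_inv =1 id}.
Proof.
move=> p; rewrite inE /= => /asboolPn h; rewrite /mpolyX_inv.
by case: pselect.
Qed.

HB.instance Definition _ := GRing.ComNzRing_hasMulInverse.Build
  {malg R[{cmonom X}]} mpolyX_mulVr mpolyX_unitP mpolyX_inv_out.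

Fact mpolyX_idomain : GRing.integral_domain_axiom {malg R[{cmonom X}]}.
Proof.
by move=> p q /mpolyX_mulf[->|->]; rewrite eqxx ?orbT.
Qed.

HB.instance Definition _ := GRing.ComUnitRing_isIntegral.Build
  {malg R[{cmonom X}]} mpolyX_idomain.

End PolyIdomain.

Section IdealPower.
Variable R : comNzRingType.
Implicit Types I J S : set R.

Definition ring_ideal I :=
  [/\ I 0, forall x y, I x -> I y -> I (x + y) & forall r x, I x -> I (r * x)].

Definition ideal_gen S : set R :=
  [set x | forall J, ring_ideal J -> S `<=` J -> J x].

Definition ideal_mul I J : set R :=
  ideal_gen [set z | exists2 x, I x & exists2 y, J y & z = x * y].

(* I^0 is the whole ring. *)
Definition ideal_pow I (n : nat) : set R := iter n (ideal_mul I) setT.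

Lemma ideal_gen_ideal S : ring_ideal (ideal_gen S).
Proof.
split=> [J [] //|x y Sx Sy J HJ sJ|r x Sx J HJ sJ]; have [_ JD JM] := HJ.
  by apply: JD; [exact: Sx | exact: Sy].
by apply: JM; exact: Sx.
Qed.

Lemma ideal_pow_ideal I n : ring_ideal (ideal_pow I n).
Proof. by case: n => [|n]; [split | exact: ideal_gen_ideal]. Qed.

End IdealPower.

Notation polyZ X := {malg int[{cmonom X}]}.
Notation ratfunQ X := {fraction {malg rat[{cmonom X}]}}.

Section FreeRadicalRing.
Variable X : choiceType.
Local Notation ZX := (polyZ X).
Local Notation QX := (ratfunQ X).

Definition monZ (m : {cmonom X}) : ZX := << m >>.

Definition monQ (m : {cmonom X}) : QX :=
  tofrac (<< m >> : {malg rat[{cmonom X}]}).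

(* The inclusion Z[X] -> Q(X). *)
Definition toQX (f : ZX) : QX := mmap intr monQ f.

Definition idX : set ZX := ideal_gen [set monZ (ucm x) | x in [set: X]].

Definition fracs (I : set ZX) : set QX :=
  [set r | exists2 f, I f & exists2 g, idX g & r = toQX f / (1 + toQX g)].

Definition Fset : set QX := fracs idX.

Fact monQ_mmorphism : mmorphism monQ.
Proof.
split=> [m1 m2|]; rewrite /monQ; last by rewrite -[RHS]tofrac1.
by rewrite -tofracM malgM_def fgmulUU mulr1.
Qed.
HB.instance Definition _ := isMultiplicative.Build _ _ monQ monQ_mmorphism.

HB.instance Definition _ := GRing.RMorphism.copy toQX (mmap intr monQ).

End FreeRadicalRing.

Section RadicalFractions.

Fact fracs_addE (K : fieldType) (f1 g1 f2 g2 : K) :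
  1 + g1 != 0 -> 1 + g2 != 0 ->
  f1 / (1 + g1) + f2 / (1 + g2) =
  (f1 * (1 + g2) + f2 * (1 + g1)) / (1 + (g1 + g2 + g1 * g2)).
Proof.
move=> h1 h2; rewrite addf_div //; congr (_ / _).
by ring.
Qed.

Fact fracs_mulE (K : fieldType) (f1 g1 f2 g2 : K) :
  f1 / (1 + g1) * (f2 / (1 + g2)) = f1 * f2 / (1 + (g1 + g2 + g1 * g2)).
Proof.
rewrite mulf_div; congr (_ / _).
by ring.
Qed.

Fact fracs_unitE (K : fieldType) (f g : K) :
  1 + g != 0 -> 1 + f / (1 + g) = (1 + (f + g)) / (1 + g).
Proof. by move=> h; field. Qed.

Fact fracs_invE (K : fieldType) (f g : K) :
  1 + g != 0 -> 1 + (f + g) != 0 ->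
  - (f / (1 + g)) / (1 + f / (1 + g)) = - f / (1 + (f + g)).
Proof.
move=> h h'; rewrite fracs_unitE // -mulNr invf_div mulrA.
by rewrite divfK.
Qed.

Fact radical_circA (K : comNzRingType) :
  associative (fun r s : K => r + r * s + s).
Proof.
by move=> x y z; ring.
Qed.

Fact radical_circC (K : comNzRingType) :
  commutative (fun r s : K => r + r * s + s).
Proof. by move=> x y; ring. Qed.

Fact radical_circV (K : fieldType) (r : K) :
  1 + r != 0 -> - r / (1 + r) + - r / (1 + r) * r + r = 0.
Proof. by move=> h; field. Qed.

Fact radical_circD (K : comNzRingType) (r s t : K) :
  r + r * (s + t) + (s + t) = r + r * s + s - r + (r + r * t + t).
Proof. by ring. Qed.

Variables (R : comNzRingType) (K : fieldType) (phi : {rmorphism R -> K}).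
Variables (I : set R) (HI : ring_ideal I).
Hypothesis HU : forall g, I g -> 1 + phi g != 0.
Implicit Types (f g h : R) (r s : K).

Let G : set K :=
  [set r | exists2 f, I f & exists2 g, I g & r = phi f / (1 + phi g)].

Let ID g h : I g -> I h -> I (g + h).
Proof. by have [_ H _] := HI; exact: H. Qed.
Let IMl g h : I h -> I (g * h).
Proof. by have [_ _ H] := HI; exact: H. Qed.
Let IMr g h : I g -> I (g * h).
Proof. by rewrite mulrC; exact: IMl. Qed.
Let IN g : I g -> I (- g).
Proof. by rewrite -mulN1r; exact: IMl. Qed.
Let Iden g h : I g -> I h -> I (g + h + g * h).
Proof. by move=> Ig Ih; apply: ID; [exact: ID | exact: IMr]. Qed.

Lemma radfrac0 : G 0.
Proof.
have [I0 _ _] := HI; exists 0 => //; exists 0 => //.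
by rewrite rmorph0 mul0r.
Qed.

Lemma radfracN r : G r -> G (- r).
Proof.
move=> [f If [g Ig ->]]; exists (- f); first exact: IN.
by exists g => //; rewrite rmorphN mulNr.
Qed.

Lemma radfracD r s : G r -> G s -> G (r + s).
Proof.
move=> [f1 If1 [g1 Ig1 ->]] [f2 If2 [g2 Ig2 ->]].
exists (f1 * (1 + g2) + f2 * (1 + g1)).
  by apply: ID; exact: IMr.
exists (g1 + g2 + g1 * g2); first exact: Iden.
rewrite (fracs_addE _ _ (HU Ig1) (HU Ig2)).
by rewrite !(rmorphD, rmorphM, rmorph1).
Qed.

Lemma radfracM r s : G r -> G s -> G (r * s).
Proof.
move=> [f1 If1 [g1 Ig1 ->]] [f2 If2 [g2 Ig2 ->]].
exists (f1 * f2); first exact: IMr.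
exists (g1 + g2 + g1 * g2); first exact: Iden.
by rewrite fracs_mulE !(rmorphD, rmorphM).
Qed.

Lemma radfrac_unit r : G r -> 1 + r != 0.
Proof.
move=> [f If [g Ig ->]]; rewrite (fracs_unitE _ (HU Ig)).
rewrite mulf_neq0 ?invr_eq0 ?(HU Ig) //.
by rewrite -rmorphD (HU (ID If Ig)).
Qed.

Lemma radfrac_inv r : G r -> G (- r / (1 + r)).
Proof.
move=> [f If [g Ig ->]]; have Ifg := ID If Ig.
have h := HU Ifg; rewrite rmorphD in h.
exists (- f); first exact: IN.
exists (f + g) => //.
by rewrite (fracs_invE (HU Ig) h) rmorphN rmorphD.
Qed.

End RadicalFractions.

Section FreeRadicalRingBrace.
Variable X : choiceType.
Local Notation ZX := (polyZ X).
Local Notation QX := (ratfunQ X).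
Implicit Types (f g : ZX) (r s : QX).

Lemma toQX_inj : injective (@toQX X).
Proof.
move=> f g /eqP; rewrite -subr_eq0 -rmorphB => /eqP fg; apply/eqP.
rewrite -subr_eq0; move: (f - g) fg => {f g} h fg.
have {fg} : \sum_(m <- msupp h) (h@_m)%:~R * monQ m = 0 by exact: fg.
pose k : {malg rat[{cmonom X}]} := \sum_(m <- msupp h) << (h@_m)%:~R *g m >>.
have -> : \sum_(m <- msupp h) (h@_m)%:~R * monQ m = tofrac k.
  rewrite /k raddf_sum; apply: eq_bigr => m _ /=.
  rewrite /monQ -(rmorph_int (@tofrac _)) -tofracM; congr tofrac.
  by rewrite mulrzl -raddfMz.
move=> /eqP; rewrite -[0]tofrac0 tofrac_eq => /eqP k0.
apply/eqP/malgP => m; rewrite mcoeff0.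
have [mh|] := boolP (m \in msupp h); last by rewrite -mcoeff_eq0 => /eqP.
have : \sum_(m' <- msupp h) (h@_m')%:~R *+ (m' == m) = 0 :> rat.
  transitivity (mcoeff m k); last by rewrite k0 mcoeff0.
  rewrite /k raddf_sum; apply: eq_bigr => m' _.
  exact/esym/mcoeffU.
rewrite (big_fsetD1 m mh) /= eqxx mulr1n big_seq_cond big1 ?addr0.
  by move/eqP; rewrite intr_eq0 => /eqP.
by move=> m'; rewrite andbT in_fsetD1 => /andP[/negbTE-> _]; rewrite mulr0n.
Qed.

Lemma idX_ideal : ring_ideal (@idX X).
Proof. exact: ideal_gen_ideal. Qed.

Lemma idX_coeff1 g : idX g -> g@_mone = 0.
Proof.
move=> Ig; apply: (Ig [set h : ZX | h@_mone = 0]).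
  split=> /= [|x y x0 y0|x y y0]; first exact: mcoeff0.
    by rewrite mcoeffD x0 y0 addr0.
  by rewrite rmorphM /= y0 mulr0.
move=> _ [x _ <-] /=; rewrite /monZ mcoeffU.
by case: eqP => // /eqP; rewrite cm1_eq1.
Qed.

Lemma idX_unit g : idX g -> 1 + toQX g != 0.
Proof.
move=> Ig; rewrite -(rmorph1 (@toQX X)) -rmorphD -(rmorph0 (@toQX X)).
rewrite (inj_eq toQX_inj); apply/eqP => /(congr1 (mcoeff mone)).
by rewrite mcoeffD mcoeff1 (idX_coeff1 Ig) mcoeff0 eqxx.
Qed.

Lemma Fset0 : Fset (0 : QX).
Proof. exact: (@radfrac0 _ _ (@toQX X) _ idX_ideal). Qed.

Lemma FsetN r : Fset r -> Fset (- r).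
Proof. exact: (@radfracN _ _ (@toQX X) _ idX_ideal). Qed.

Lemma FsetD r s : Fset r -> Fset s -> Fset (r + s).
Proof. exact: (@radfracD _ _ (@toQX X) _ idX_ideal idX_unit). Qed.

Lemma FsetM r s : Fset r -> Fset s -> Fset (r * s).
Proof. exact: (@radfracM _ _ (@toQX X) _ idX_ideal). Qed.

Lemma Fset_unit r : Fset r -> 1 + r != 0.
Proof. exact: (@radfrac_unit _ _ (@toQX X) _ idX_ideal idX_unit). Qed.

Lemma Fset_inv r : Fset r -> Fset (- r / (1 + r)).
Proof. exact: (@radfrac_inv _ _ (@toQX X) _ idX_ideal idX_unit). Qed.

Definition F_mk r (h : Fset r) : @Fset X := exist _ r (mem_set h).

Let valF (a : @Fset X) : Fset (val a). Proof. exact: set_valP. Qed.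

Fact F_circP (a b : @Fset X) :
  Fset (val a + val a * val b + val b).
Proof. by apply: FsetD => //; apply: FsetD => //; exact: FsetM. Qed.

Definition F_add (a b : @Fset X) := F_mk (FsetD (valF a) (valF b)).
Definition F_opp (a : @Fset X) := F_mk (FsetN (valF a)).
Definition F_circ (a b : @Fset X) := F_mk (F_circP a b).
Definition F_inv (a : @Fset X) := F_mk (Fset_inv (valF a)).

Fact F_add_group : is_group F_add (F_mk Fset0) F_opp.
Proof.
split=> [a b c|a|a|a|a]; apply: val_inj => /=.
- exact: addrA.
- exact: add0r.
- exact: addr0.
- exact: addNr.
exact: addrN.
Qed.

Fact F_circC : commutative F_circ.
Proof.
by move=> a b; apply: val_inj; exact: (@radical_circC QX).
Qed.

Fact F_circ_group : is_group F_circ (F_mk Fset0) F_inv.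
Proof.
have l1 : left_id (F_mk Fset0) F_circ.
  by move=> a; apply: val_inj => /=; rewrite mul0r !add0r.
have lV : left_inverse (F_mk Fset0) F_inv F_circ.
  by move=> a; apply: val_inj; exact: (@radical_circV QX _ (Fset_unit (valF a))).
split=> // [a b c|a|a]; [|by rewrite F_circC l1 | by rewrite F_circC lV].
by apply: val_inj; exact: (@radical_circA QX).
Qed.

Fact F_circD (a b c : @Fset X) :
  F_circ a (F_add b c) = F_add (F_add (F_circ a b) (F_opp a)) (F_circ a c).
Proof.
by apply: val_inj; exact: (@radical_circD QX).
Qed.

(* The free commutative radical ring on X, as a skew brace. *)
Definition Fbrace : skewBrace :=
  @SkewBrace (@Fset X) _ _ _ _ _ _ F_add_group F_circ_group F_circD.

Definition F_val (a : Fbrace) : QX := \val (a : @Fset X).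

End FreeRadicalRingBrace.

Section GradedPiece.
Variables (R : comNzRingType) (I : set R) (n : nat).

Lemma ring_ideal_zmod (J : set R) : ring_ideal J ->
  zmod_closed (fun x : R => x \in J).
Proof.
move=> [J0 JD JM]; split=> [|x y]; first by apply/mem_set.
move=> /set_mem Jx /set_mem Jy; apply/mem_set; apply: JD => //.
by rewrite -mulN1r; exact: JM.
Qed.

Definition in_pow : pred R := fun x => x \in ideal_pow I n.
HB.instance Definition _ := GRing.isZmodClosed.Build R in_pow
  (ring_ideal_zmod (ideal_pow_ideal I n)).

Record pow_type := PowType { pow_val :> R; pow_valP : pow_val \in in_pow }.
HB.instance Definition _ := [isSub for pow_val].
HB.instance Definition _ := [Choice of pow_type by <:].
HB.instance Definition _ := [SubChoice_isSubZmodule of pow_type by <:].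

Definition in_next_pow : pow_type -> bool :=
  fun x => val x \in ideal_pow I n.+1.

Fact in_next_pow_zmod : zmod_closed in_next_pow.
Proof.
have [h0 hB] := ring_ideal_zmod (ideal_pow_ideal I n.+1).
split=> [|x y hx hy]; first by rewrite unfold_in /in_next_pow raddf0.
by rewrite unfold_in /in_next_pow raddfB; exact: hB.
Qed.
HB.instance Definition _ := GRing.isZmodClosed.Build pow_type in_next_pow
  in_next_pow_zmod.

(* I^n / I^(n+1) *)
Definition pow_quot : zmodType := Quotient.quot (GRing.ZmodClosed.clone pow_type in_next_pow _).

Definition pow_pi (x : pow_type) : pow_quot := \pi_(pow_quot) x.

End GradedPiece.

Definition monomials (X : choiceType) (n : nat) : choiceType :=
  {m : {cmonom X} | mdeg m == n}.

(* The free abelian group on a set: finitely supported functions to Z. *)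
Definition freeAb (K : choiceType) : zmodType := {malg int[K]}.

(* Main.v *)
(* Let I be the ideal of Z[X] generated by X. A polynomial lies in I^n iff it
   has no monomial of degree below n, so taking the degree-n part identifies
   I^n/I^(n+1) with the free abelian group on the monomials of degree n. In F
   the product * is multiplication of functions, and
   f1 f2/(1+g) = (f1/(1+g)) f2 with f1 in I^n and f2 in I gives the description
   of F^(n) by induction. Finally f/(1+g) = f'/(1+g') forces
   f - f' = f' g - f g' in I^(n+1), so the degree-n part of the numerator is well
   defined; it is additive by the same kind of congruence, it kills exactly
   F^(n+1), and a o b = a + a*b + b with a*b in F^(n+1). *)
Require Import Defs.
From HB Require Import structures.
From mathcomp Require Import all_boot all_order all_algebra.
From mathcomp Require Import boolp classical_sets.
From mathcomp Require Import finmap monalg.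
From mathcomp Require Import ring.

Set Implicit Arguments.
Unset Strict Implicit.
Unset Printing Implicit Defensive.

Import GRing.Theory.

Local Open Scope classical_set_scope.
Local Open Scope ring_scope.

(** * Bijections and powers of an ideal *)

Lemma inj_surj_bijective (S T : Type) (f : S -> T) :
  injective f -> (forall y, exists x, f x = y) -> bijective f.
Proof.
move=> f_inj f_surj; have fK y := svalP (cid (f_surj y)).
by exists (fun y => sval (cid (f_surj y))) => x //; apply: f_inj; rewrite fK.
Qed.

(** Since [ideal_pow I 0] is the whole ring, the first power is the product of I with the ring:
    absorption gives one inclusion, the factor 1 the other. *)
Lemma ideal_pow1 (R : comNzRingType) (I : set R) :
  ring_ideal I -> ideal_pow I 1 = I.
Proof.
move=> HI; have [_ _ IM] := HI; apply/seteqP; split=> x Ix.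
  by apply: Ix => // _ [y Iy [z _ ->]]; rewrite mulrC; exact: IM.
by move=> J _; apply; exists x => //; exists 1; rewrite ?mulr1.
Qed.

Lemma ideal_powM (R : comNzRingType) (I : set R) n x y :
  I x -> ideal_pow I n y -> ideal_pow I n.+1 (x * y).
Proof. by move=> Ix Iy J _; apply; exists x => //; exists y. Qed.

(** * Powers of the ideal of the variables and lowest degrees of polynomials *)

Section OrderOfVanishing.
Variable X : choiceType.
Implicit Types (f g : polyZ X) (m : {cmonom X}).

Definition vanish_below n : set (polyZ X) :=
  [set f | forall m, (mdeg m < n)%N -> f@_m = 0].

(** Every monomial in the support of a product is a product of monomials from the two supports, and
    degrees add. *)
Lemma vanish_belowM i j f g :
  vanish_below i f -> vanish_below j g -> vanish_below (i + j) (f * g).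
Proof.
move=> fi gj m lm; apply: mcoeff_outdom; apply/negP => /msuppM_le.
move=> [m1 [m2 [m1f m2g def_m]]]; move: lm; rewrite def_m mdegM ltnNge.
case/negP; apply: leq_add; rewrite leqNgt; apply/negP.
  by move=> /fi/eqP; rewrite mcoeff_eq0 m1f.
by move=> /gj/eqP; rewrite mcoeff_eq0 m2g.
Qed.

Lemma vanish_below_ideal n : ring_ideal (vanish_below n).
Proof.
split=> [m _|f g fn gn m lm|f g gn]; first exact: mcoeff0.
  by rewrite mcoeffD fn // gn // addr0.
by rewrite -[n]add0n; apply: vanish_belowM.
Qed.

Lemma vanish_below_idX f : idX f -> vanish_below 1 f.
Proof.
move=> If m; rewrite ltnS leqn0 mdeg_eq0 => /eqP ->; exact: idX_coeff1.
Qed.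

(** Induction on n: split off one variable that occurs in m, which lowers the degree by one. *)
Lemma idX_pow_mon n m : (n <= mdeg m)%N -> ideal_pow (@idX X) n (monZ m).
Proof.
elim: n m => [//|n IHn] m lnm.
have /fset0Pn[x xm] : finsupp m != fset0.
  by apply: contraTneq lnm => m0; rewrite mdegE m0 big_seq_fset0.
have def_m : m = mmul (ucm x) (divcm m (ucm x)).
  apply/eqP/cmP => y; rewrite cmM divcmE subnKC // cmU.
  by case: eqP => // <-; rewrite lt0n cmE_neq0.
rewrite def_m.
have -> : monZ (mmul (ucm x) (divcm m (ucm x))) =
    monZ (ucm x) * monZ (divcm m (ucm x)).
  by rewrite /monZ malgM_def fgmulUU mulr1.
apply: ideal_powM; first by move=> J _; apply; exists x.
by apply: IHn; move: lnm; rewrite {1}def_m mdegM mdegU.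
Qed.

(** Turns membership in an ideal power into a condition on coefficients. For the second inclusion f
    is expanded into its monomials, all of degree at least n. *)
Lemma idX_powE n : ideal_pow (@idX X) n = vanish_below n.
Proof.
apply/seteqP; split=> f.
  elim: n f => [//|n IHn] f; apply; first exact: vanish_below_ideal.
  move=> _ [g Ig [h Ih ->]]; rewrite -[n.+1]add1n.
  by apply: vanish_belowM; [exact: vanish_below_idX | exact: IHn].
have [I0 ID IM] := ideal_pow_ideal (@idX X) n.
move=> fn; rewrite [f]monalgE big_seq; apply: big_ind => // m mf.
have -> : << f@_m *g m >> = (f@_m)%:~R * monZ m :> polyZ X.
  by rewrite /monZ mulrzl -raddfMz /= intz.
apply/IM/idX_pow_mon; rewrite leqNgt; apply/negP => /fn/eqP.
by rewrite mcoeff_eq0 mf.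
Qed.

End OrderOfVanishing.

(** * Arithmetic of fractions f/(1+g) *)

Lemma frac_numer_subE (R : comNzRingType) (f1 g1 f2 g2 : R) :
  f1 * (1 + g2) + f2 * (1 + g1) - (f1 + f2) = g2 * f1 + g1 * f2.
Proof. by ring. Qed.

Section MorphFractions.
Variables (R : comNzRingType) (K : fieldType) (phi : {rmorphism R -> K}).
Implicit Types f g : R.

Lemma morph_frac_add f1 g1 f2 g2 : 1 + phi g1 != 0 -> 1 + phi g2 != 0 ->
  phi f1 / (1 + phi g1) + phi f2 / (1 + phi g2) =
  phi (f1 * (1 + g2) + f2 * (1 + g1)) / (1 + phi (g1 + g2 + g1 * g2)).
Proof. by move=> h1 h2; rewrite fracs_addE // !(rmorphD, rmorphM, rmorph1). Qed.

Lemma morph_frac_mul f1 g1 f2 g2 :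
  phi f1 / (1 + phi g1) * (phi f2 / (1 + phi g2)) =
  phi (f1 * f2) / (1 + phi (g1 + g2 + g1 * g2)).
Proof. by rewrite fracs_mulE !(rmorphD, rmorphM). Qed.

(** Cross-multiplication, arranged so that each term on the right carries a factor g1 or g2: with
    these in I and numerators in I^n, the numerators agree modulo I^(n+1). *)
Lemma morph_frac_eq f1 g1 f2 g2 : injective phi ->
  1 + phi g1 != 0 -> 1 + phi g2 != 0 ->
  phi f1 / (1 + phi g1) = phi f2 / (1 + phi g2) ->
  f1 - f2 = f2 * g1 - f1 * g2.
Proof.
move=> phi_inj h1 h2 /eqP; rewrite eqr_div // -(rmorph1 phi) -!rmorphD -!rmorphM.
move=> /eqP/phi_inj; rewrite !mulrDr !mulr1 => E.
have -> : f2 * g1 = f1 + f1 * g2 - f2 by rewrite E addrAC addrN add0r.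
by ring.
Qed.

End MorphFractions.

Section PolyFractions.
Variable X : choiceType.
Local Notation Q := (@toQX X).
Implicit Types f g : polyZ X.

Lemma toQX_frac_add f1 g1 f2 g2 : idX g1 -> idX g2 ->
  Q f1 / (1 + Q g1) + Q f2 / (1 + Q g2) =
  Q (f1 * (1 + g2) + f2 * (1 + g1)) / (1 + Q (g1 + g2 + g1 * g2)).
Proof.
move=> /idX_unit h1 /idX_unit h2.
by have := @morph_frac_add _ _ Q f1 g1 f2 g2 h1 h2; apply.
Qed.

Lemma toQX_frac_mul f1 g1 f2 g2 :
  Q f1 / (1 + Q g1) * (Q f2 / (1 + Q g2)) =
  Q (f1 * f2) / (1 + Q (g1 + g2 + g1 * g2)).
Proof. by have := @morph_frac_mul _ _ Q f1 g1 f2 g2; apply. Qed.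

Lemma toQX_frac_opp f g : - (Q f / (1 + Q g)) = Q (- f) / (1 + Q g).
Proof. by rewrite (rmorphN Q f) mulNr. Qed.

Lemma toQX_frac0 g : Q 0 / (1 + Q g) = 0.
Proof. by rewrite (rmorph0 Q) mul0r. Qed.

Lemma toQX_fracD f1 f2 g :
  Q (f1 + f2) / (1 + Q g) = Q f1 / (1 + Q g) + Q f2 / (1 + Q g).
Proof. by rewrite (rmorphD Q f1) mulrDl. Qed.

Lemma toQX_fracM f1 f2 g :
  Q (f1 * f2) / (1 + Q g) = Q f1 / (1 + Q g) * Q f2.
Proof. by rewrite (rmorphM Q f1) mulrAC. Qed.

Lemma toQX_frac1 f : Q f / (1 + Q 0) = Q f.
Proof. by rewrite (rmorph0 Q) addr0 divr1. Qed.

Lemma toQX_frac_eq f1 g1 f2 g2 : idX g1 -> idX g2 ->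
  Q f1 / (1 + Q g1) = Q f2 / (1 + Q g2) -> f1 - f2 = f2 * g1 - f1 * g2.
Proof.
move=> /idX_unit h1 /idX_unit h2.
by have := @morph_frac_eq _ _ Q f1 g1 f2 g2 (@toQX_inj X) h1 h2; apply.
Qed.

End PolyFractions.

(** * The series F^(n) as sets of fractions *)

Section Series.
Variable X : choiceType.
Local Notation I := (@idX X).
Implicit Types a b : Fbrace X.

Lemma F_val_inj : injective (@F_val X).
Proof. exact: val_inj. Qed.

(** Stated with the first power so that it starts the induction on n and serves as second factor in
    [fracs_powM]. *)
Lemma F_valP a : fracs (ideal_pow I 1) (F_val a).
Proof. rewrite (ideal_pow1 (@idX_ideal X)); exact: set_valP. Qed.

Lemma F_valK r (h : Fset r) : F_val (F_mk h : Fbrace X) = r.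
Proof. by []. Qed.

Lemma F_valD a b : F_val (sb_add a b) = F_val a + F_val b.
Proof. by []. Qed.

Lemma F_valN a : F_val (sb_opp a) = - F_val a.
Proof. by []. Qed.

Lemma F_val_star a b : F_val (star a b) = F_val a * F_val b.
Proof.
rewrite /F_val /star /=; set x := val a; set y := val b.
by ring.
Qed.

Lemma idX_pow_sub n : (0 < n)%N -> ideal_pow I n `<=` I.
Proof.
move=> n0 f; rewrite -{2}(ideal_pow1 (@idX_ideal X)) !idX_powE => fn m lm.
exact: fn (leq_trans lm n0).
Qed.

Lemma fracs_pow_subgroup n :
  add_subgroup [set a : Fbrace X | fracs (ideal_pow I n) (F_val a)].
Proof.
have [I0 ID IM] := ideal_pow_ideal I n; have [_ JD JM] := @idX_ideal X.
split=> [|a b [f1 If1 [g1 Ig1 E1]] [f2 If2 [g2 Ig2 E2]]|a [f If [g Ig E]]] /=.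
- by exists 0 => //; exists 0; [have [] := @idX_ideal X | rewrite toQX_frac0].
- exists (f1 * (1 + g2) + f2 * (1 + g1)).
    by apply: ID; rewrite mulrC; exact: IM.
  exists (g1 + g2 + g1 * g2); first by apply: (JD); [exact: JD | exact: JM].
  rewrite F_valD E1 E2; exact: toQX_frac_add.
exists (- f); first by rewrite -mulN1r; exact: IM.
by exists g => //; rewrite F_valN E; exact: toQX_frac_opp.
Qed.

Lemma fracs_powM i j (r s : ratfunQ X) : fracs (ideal_pow I i) r ->
  fracs (ideal_pow I j) s -> fracs (ideal_pow I (i + j)) (r * s).
Proof.
have [_ JD JM] := @idX_ideal X.
move=> [f1 If1 [g1 Ig1 ->]] [f2 If2 [g2 Ig2 ->]].
exists (f1 * f2); first by move: If1 If2; rewrite !idX_powE; exact: vanish_belowM.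
exists (g1 + g2 + g1 * g2); first by apply: (JD); [exact: JD | exact: JM].
exact: toQX_frac_mul.
Qed.

(** One direction only needs the generators, which are products of functions. For the other, the
    denominator 1+g is fixed and the numerator is reduced to a single product x y by minimality of
    the generated ideal. *)
Lemma bseries_fracs n a : (0 < n)%N ->
  bseries (Fbrace X) n a <-> fracs (ideal_pow I n) (F_val a).
Proof.
case: n => // n _; elim: n a => [|n IHn] a.
  by split=> // _; exact: F_valP.
rewrite bseriesS //; split=> [a_gen|[f If [g Ig def_a]]].
  apply: (a_gen _ (fracs_pow_subgroup n.+2)) => _ [b /IHn bn [c ->]].
  by have := fracs_powM bn (F_valP c); rewrite addn1 -F_val_star.
have [I0 ID IM] := ideal_pow_ideal I n.+1; have [J0 JD JM] := @idX_ideal X.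
have [G0 GD GN] := add_gen_subgroup [set c | exists2 a, bseries (Fbrace X) n.+1 a
  & exists b : Fbrace X, c = star a b].
(* Quantifying over the multiplier h makes J an ideal: star_gen is not
   visibly stable under multiplication by polynomials outside I. *)
pose J : set (polyZ X) := [set f | I f /\ forall h b,
  F_val b = toQX (h * f) / (1 + toQX g) -> star_gen (bseries (Fbrace X) n.+1) b].
(* The multiplier h = 1 gives back a itself. *)
suff : J f by case=> _ /(_ 1 a); rewrite mul1r; apply.
have in_F h : I h -> Fset (toQX h / (1 + toQX g)).
  by move=> Ih; exists h => //; exists g.
have JI : ring_ideal J.
  split=> [|x y [Ix Jx] [Iy Jy]|r x [Ix Jx]].
  - split=> // h b; rewrite mulr0 toQX_frac0 => E.
    by have -> : b = sb_zero by exact: F_val_inj.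
  - split=> [|h b]; first exact: JD.
    rewrite mulrDr toQX_fracD => E.
    have -> : b = sb_add (F_mk (in_F _ (JM h _ Ix)) : Fbrace X)
      (F_mk (in_F _ (JM h _ Iy)) : Fbrace X).
      exact: F_val_inj.
    by apply: (GD); [exact: (Jx h) | exact: (Jy h)].
  by split=> [|h b]; [exact: JM | rewrite mulrA; exact: Jx].
apply: If JI _ => _ [x Ix [y Iy ->]]; split=> [|h b E].
  by rewrite mulrC; exact: JM.
have Fx : Fset (toQX x).
  by exists x; [|exists 0; [|rewrite toQX_frac1]].
(* The whole denominator goes to the factor h y/(1+g), which the induction hypothesis places in the
   previous term of the series; x stays a polynomial. *)
have [z Iz Ez] : exists2 z, ideal_pow I n.+1 z &
    F_val b = toQX z / (1 + toQX g) * toQX x.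
  exists (h * y); first exact: IM.
  rewrite E (mulrC x) mulrA; exact: toQX_fracM.
have Fz := in_F z (idX_pow_sub (ltn0Sn n) Iz).
have -> : b = star (F_mk Fz : Fbrace X) (F_mk Fx : Fbrace X).
  by apply: F_val_inj; rewrite F_val_star Ez.
apply: add_gen_sub; exists (F_mk Fz); last by exists (F_mk Fx).
by apply/(IHn _); exists z; [|exists g].
Qed.

End Series.

(** * The homogeneous part of degree n and the quotient I^n/I^(n+1) *)

Section LeadingForm.
Variables (X : choiceType) (n : nat).
Implicit Types f g : polyZ X.

(** [insub] discards the monomials of other degrees. The domain is all of Z[X], so additivity
    involves no membership conditions. *)
Definition homog_part f : freeAb (monomials X n) :=
  \sum_(m <- msupp f)
    if insub m is Some m' then << f@_m *g (m' : monomials X n) >> else 0.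

Lemma homog_partE f (m : monomials X n) : (homog_part f)@_m = f@_(val m).
Proof.
rewrite /homog_part raddf_sum /=.
have [mf|] := msuppP f (val m); last first.
  move=> mf; rewrite big_seq big1 // => m' m'f; case: insubP => [u _ uE|_].
    by rewrite mcoeffU; case: eqP => // E; move: mf; rewrite -E uE m'f.
  exact: mcoeff0.
rewrite (big_fsetD1 (val m)) //= valK mcoeffUU big_seq big1 ?addr0 // => m'.
rewrite in_fsetD1 => /andP[m'm _]; case: insubP => [u _ uE|_].
  by rewrite mcoeffU; case: eqP => // E; rewrite -uE E eqxx in m'm.
exact: mcoeff0.
Qed.

Lemma homog_part_is_additive : additive homog_part.
Proof.
move=> f g; apply/malgP => m.
rewrite (homog_partE (f - g)) [LHS]mcoeffB -(homog_partE f) -(homog_partE g).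
exact/esym/(@mcoeffB (monomials X n) int m).
Qed.
HB.instance Definition _ := GRing.isZmodMorphism.Build _ _ homog_part
  homog_part_is_additive.

(** For f in I^n, only the coefficients in degree exactly n can obstruct membership in I^(n+1). *)
Lemma homog_part_eq0 f : ideal_pow (@idX X) n f ->
  homog_part f = 0 <-> ideal_pow (@idX X) n.+1 f.
Proof.
rewrite !idX_powE => fn; split=> [f0 m|fn1].
  rewrite ltnS leq_eqVlt => /orP[mn|]; last exact: fn.
  by rewrite -[m]/(val (Sub m mn : monomials X n)) -homog_partE f0 mcoeff0.
by apply/malgP => m; rewrite homog_partE mcoeff0 fn1 // (eqP (valP m)).
Qed.

Lemma homog_part_mon (m : monomials X n) : homog_part (monZ (val m)) = << m >>.
Proof. by apply/malgP => m'; rewrite homog_partE !mcoeffU (inj_eq val_inj). Qed.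

Lemma homog_part_surj (k : freeAb (monomials X n)) :
  exists2 f, ideal_pow (@idX X) n f & homog_part f = k.
Proof.
have [I0 ID IM] := ideal_pow_ideal (@idX X) n.
exists (\sum_(m <- msupp k) (k@_m)%:~R * monZ (val m)).
  apply: big_ind => // m _; apply: IM; apply: idX_pow_mon.
  by rewrite (eqP (valP m)).
rewrite raddf_sum [RHS]monalgE; apply: eq_bigr => m _.
by rewrite mulrzl raddfMz /= homog_part_mon -raddfMz /= intz.
Qed.

Definition pow_theta (u : pow_quot (@idX X) n) : freeAb (monomials X n) :=
  homog_part (pow_val (repr u)).

(** Used for independence of the chosen numerator or representative: the difference also lies in
    I^n, so the kernel criterion applies to it. *)
Lemma homog_part_eq f g : ideal_pow (@idX X) n.+1 (f - g) ->
  homog_part f = homog_part g.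
Proof.
move=> fg1; apply/eqP; rewrite -subr_eq0 -(raddfB homog_part); apply/eqP.
apply/(homog_part_eq0 _) => //; move: fg1; rewrite !idX_powE => fg1 m mn.
by rewrite fg1 // (ltn_trans mn).
Qed.

Lemma pow_piP (u v : pow_type (@idX X) n) :
  pow_pi u = pow_pi v <-> ideal_pow (@idX X) n.+1 (pow_val u - pow_val v).
Proof.
have E : ((u - v) \in @in_next_pow _ (@idX X) n) = (pow_pi u == pow_pi v).
  exact: Quotient.idealrBE.
split=> [/eqP|uv]; first by rewrite -E => /set_mem.
by apply/eqP; rewrite -E; exact: mem_set.
Qed.

Lemma pow_thetaE (u : pow_type (@idX X) n) :
  pow_theta (pow_pi u) = homog_part (pow_val u).
Proof. by apply/homog_part_eq/pow_piP; rewrite /pow_pi reprK. Qed.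

Lemma pow_theta_is_additive : additive pow_theta.
Proof.
elim/quotW => u; elim/quotW => v; rewrite -raddfB.
by rewrite !pow_thetaE -raddfB.
Qed.
HB.instance Definition _ := GRing.isZmodMorphism.Build _ _ pow_theta
  pow_theta_is_additive.

Lemma pow_theta_inj : injective pow_theta.
Proof.
elim/quotW => u; elim/quotW => v; rewrite !pow_thetaE => E.
apply/pow_piP/(homog_part_eq0 _); last first.
  by rewrite (raddfB homog_part); apply/eqP; rewrite subr_eq0; apply/eqP.
have [h0 hB] := ring_ideal_zmod (ideal_pow_ideal (@idX X) n).
by apply: set_mem; apply: hB; exact: pow_valP.
Qed.

Lemma pow_theta_surj k : exists u, pow_theta u = k.
Proof.
have [f fn fk] := homog_part_surj k.
by exists (pow_pi (PowType (mem_set fn))); rewrite pow_thetaE.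
Qed.

End LeadingForm.

(** * The map xi on F^(n) and its factorisation through the quotient *)

Lemma bseries_val_star (B : skewBrace) k (a b : bseriesB B k) :
  bseries_val (star a b) = star (bseries_val a) (bseries_val b).
Proof. by []. Qed.

Section XiMap.
Variables (X : choiceType) (n : nat).
Hypothesis n_gt0 : (0 < n)%N.
Local Notation I := (@idX X).
Local Notation Fn := (bseriesB (Fbrace X) n).
Implicit Types (a b : Fn) (f g : polyZ X).

Definition frac_val (a : Fn) : ratfunQ X := F_val (bseries_val a).

Lemma frac_valP a : fracs (ideal_pow I n) (frac_val a).
Proof. by apply/(bseries_fracs _ n_gt0); exact: set_valP. Qed.

(** The numerator is picked by choice; [xi_mapE] shows that any other one gives the same value. *)
Definition xi_map (a : Fn) : freeAb (monomials X n) :=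
  homog_part n (s2val (cid2 (frac_valP a))).

(** Two numerators of one element differ by f g' - f' g, and a product of an element of I^n with one
    of I lies in I^(n+1). *)
Lemma xi_mapE a f g : ideal_pow I n f -> idX g ->
  frac_val a = toQX f / (1 + toQX g) -> xi_map a = homog_part n f.
Proof.
move=> If Ig E; rewrite /xi_map; case: cid2 => /= f' If' [g' Ig' E'].
apply: homog_part_eq; rewrite E in E'.
have -> := toQX_frac_eq Ig' Ig (esym E').
have [_ ID IM] := ideal_pow_ideal I n.+1.
apply: ID; first by rewrite mulrC; exact: ideal_powM.
by rewrite -mulN1r; apply: IM; rewrite mulrC; exact: ideal_powM.
Qed.

Lemma xi_mapD a b : xi_map (sb_add a b) = xi_map a + xi_map b.
Proof.
have [f1 If1 [g1 Ig1 E1]] := frac_valP a.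
have [f2 If2 [g2 Ig2 E2]] := frac_valP b.
have [_ ID IM] := ideal_pow_ideal I n; have [_ JD JM] := @idX_ideal X.
have [_ KD _] := ideal_pow_ideal I n.+1.
rewrite (xi_mapE If1 Ig1 E1) (xi_mapE If2 Ig2 E2) -raddfD.
have E : frac_val (sb_add a b) =
    toQX (f1 * (1 + g2) + f2 * (1 + g1)) / (1 + toQX (g1 + g2 + g1 * g2)).
  rewrite -[LHS]/(frac_val a + frac_val b) E1 E2; exact: toQX_frac_add.
have Ig : idX (g1 + g2 + g1 * g2) by apply: (JD); [exact: JD | exact: JM].
rewrite (xi_mapE _ Ig E); last by apply: ID; rewrite mulrC; exact: IM.
apply: homog_part_eq.
have -> := frac_numer_subE f1 g1 f2 g2.
by apply: KD; exact: ideal_powM.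
Qed.

Lemma xi_map_eq0 a : xi_map a = 0 <-> bseries_next a.
Proof.
have nextE := bseries_fracs (bseries_val a) (ltn0Sn n).
have [f If [g Ig E]] := frac_valP a; rewrite (xi_mapE If Ig E).
split=> [/(homog_part_eq0 If) If1|/nextE[f' If' [g' Ig' E']]].
  by apply/nextE; exists f; [|exists g].
have If'n : ideal_pow I n f'.
  by move: If'; rewrite !idX_powE => If' m mn; apply: If'; exact: ltn_trans mn _.
(* The same element now has a numerator f' in I^(n+1), and well-definedness lets f' replace f. *)
rewrite -(xi_mapE If Ig E) (xi_mapE If'n Ig' E').
exact/(homog_part_eq0 If'n).
Qed.

(** In a ∘ b = a + a * b + b the middle term is a product of a fraction from I^n and one from I, so
    it lies in F^(n+1) and is killed. *)
Lemma xi_map_circ a b : xi_map (sb_circ a b) = xi_map a + xi_map b.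
Proof.
rewrite sb_circE lamE (xi_mapD a) (xi_mapD (star a b)).
suff -> : xi_map (star a b) = 0 by rewrite add0r.
apply/xi_map_eq0/(bseries_fracs _ (ltn0Sn n)).
have -> : F_val (bseries_val (star a b)) = frac_val a * frac_val b.
  by rewrite bseries_val_star; exact: F_val_star.
by rewrite -addn1; apply: (fracs_powM (frac_valP a)); exact: F_valP.
Qed.

Lemma xi_map_surj k : exists a, xi_map a = k.
Proof.
have [f If <-] := homog_part_surj k; have [J0 _ _] := @idX_ideal X.
have Ff : fracs (ideal_pow I n) (toQX f).
  by exists f; [|exists 0; [|rewrite toQX_frac1]].
have FF : Fset (toQX f).
  by exists f; [exact: idX_pow_sub If|exists 0; [|rewrite toQX_frac1]].
have Sf : bseries (Fbrace X) n (F_mk FF : Fbrace X).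
  exact/(bseries_fracs _ n_gt0).
exists (sub_mk Sf : Fn); apply: (xi_mapE If J0).
by rewrite toQX_frac1.
Qed.

Definition xi_quot (q : bseries_quot (Fbrace X) n) : freeAb (monomials X n) :=
  xi_map (repr (q : Defs.quot_type (bseries_next_ideal (Fbrace X) n))).

Lemma xi_quotE a : xi_quot (bseries_pi a) = xi_map a.
Proof.
rewrite /xi_quot /bseries_pi /quotBrace_pi.
have /xi_map_eq0 := repr_quot (bseries_next_ideal (Fbrace X) n) a.
(* Write a as r + (-r + a), whose second summand lies in F^(n+1). *)
set r := repr _ => r0; rewrite -[in RHS](grpVK (sb_add_group Fn) r a).
by rewrite xi_mapD r0 addr0.
Qed.

Lemma bseries_pi_surj (q : bseries_quot (Fbrace X) n) :
  exists a, bseries_pi a = q.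
Proof.
exists (repr (q : Defs.quot_type (bseries_next_ideal (Fbrace X) n))).
exact: reprK.
Qed.

Lemma xi_quotD q r : xi_quot (sb_add q r) = xi_quot q + xi_quot r.
Proof.
have [[a <-] [b <-]] := (bseries_pi_surj q, bseries_pi_surj r).
rewrite (xi_quotE a) (xi_quotE b) -xi_mapD -[RHS]xi_quotE.
congr xi_quot; exact: pi_addE.
Qed.

Lemma xi_quot_circ q r : xi_quot (sb_circ q r) = xi_quot q + xi_quot r.
Proof.
have [[a <-] [b <-]] := (bseries_pi_surj q, bseries_pi_surj r).
rewrite (xi_quotE a) (xi_quotE b) -xi_map_circ -[RHS]xi_quotE.
congr xi_quot; exact: pi_circE.
Qed.

Lemma xi_quot_inj : injective xi_quot.
Proof.
move=> q r; have [[a <-] [b <-]] := (bseries_pi_surj q, bseries_pi_surj r).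
rewrite !xi_quotE => ab; apply/Defs.quotP/xi_map_eq0.
(* Adding the value at a turns the argument -a + b into b. *)
apply: (addrI (xi_map a)); rewrite -xi_mapD (grpVK (sb_add_group Fn)).
by rewrite [RHS]addr0; exact: esym ab.
Qed.

End XiMap.

(** * Identification of F^(n) and of F^(n)/F^(n+1) *)

Unset Implicit Arguments.

Theorem theorem8p10 (X : choiceType) (x0 : X) (n : nat) (hn : (0 < n)%N) :
  @F_val X @` bseries (Fbrace X) n = fracs (ideal_pow (@idX X) n) /\
  exists theta :
    {additive pow_quot (@idX X) n -> freeAb (monomials X n)},
  [/\ bijective theta,
      forall (m : monomials X n) (u : pow_type (@idX X) n),
        pow_val u = monZ (\val m) ->
        theta (pow_pi u) = (<< m >> : {malg int[monomials X n]})
    & exists xi :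
        bseriesB (Fbrace X) n -> trivBrace (freeAb (monomials X n)),
      [/\ brace_hom xi,
          forall (f : pow_type (@idX X) n) (g : polyZ X)
            (a : bseriesB (Fbrace X) n),
            idX g ->
            F_val (bseries_val a) = toQX (pow_val f) / (1 + toQX g) ->
            xi a = theta (pow_pi f)
        & exists phi :
            bseries_quot (Fbrace X) n -> trivBrace (freeAb (monomials X n)),
          brace_iso phi /\ forall a, phi (bseries_pi a) = xi a]].
Proof.
split.
  apply/seteqP; split=> [_ [a an <-]|r rn]; first exact/(bseries_fracs _ hn).
  (* As n >= 1, I^n is contained in I, so r belongs to F. *)
  have Fr : Fset r.
    by have [f fn [g Ig ->]] := rn; exists f; [exact: idX_pow_sub fn | exists g].
  by exists (F_mk Fr : Fbrace X); [exact/(bseries_fracs _ hn) | exact: F_valK].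
exists (@pow_theta X n); split.
- exact: inj_surj_bijective (@pow_theta_inj X n) (@pow_theta_surj X n).
- by move=> m u um; rewrite [LHS]pow_thetaE um homog_part_mon.
exists (xi_map hn); split.
- by split; [exact: xi_mapD | exact: xi_map_circ].
- move=> f g a Ig E; rewrite [RHS]pow_thetaE.
  exact: (xi_mapE hn (set_mem (pow_valP f)) Ig E).
exists (xi_quot hn); split; last exact: xi_quotE.
split; first by split; [exact: xi_quotD | exact: xi_quot_circ].
apply: inj_surj_bijective => [|k]; first exact: xi_quot_inj.
by have [a <-] := xi_map_surj hn k; exists (bseries_pi a); rewrite xi_quotE.
Qed.
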